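(* Let $\nu$ be the uniform probability distribution on $[0,1]$, and for $j\in\mathbb{N}$ let $C_j=\{(x,y)\in\mathbb{R}^2 : -\frac1j\le x\le 1,\ y=x+\frac1j\}$. Then the constrained quantization dimension $D(\nu)$ of $\nu$ with respect to the family $\{C_j : j\in\mathbb{N}\}$ exists, and $D(\nu)=2$.
   Context: A real number $x$ is identified with $(x,0)\in\mathbb{R}^2$, so $\nu$ is regarded as a Borel probability measure on $\mathbb{R}^2$ supported on $[0,1]\times\{0\}$; $d$ denotes Euclidean distance on $\mathbb{R}^2$. The $n$th constrained quantization error of $\nu$ with respect to $\{C_j\}$ is $$R_n(\nu)=\inf\Big\{\int \min_{a\in\gamma} d(x,a)^2\,d\nu(x) : \gamma\subseteq\bigcup_{j=1}^n C_j,\ 1\le \mathrm{card}(\gamma)\le n\Big\}.$$ When $(R_n(\nu))_n$ is strictly decreasing, put $R_\infty(\nu)=\lim_{n\to\infty}R_n(\nu)$. The constrained quantization dimension of $\nu$ is $$D(\nu)=\lim_{n\to\infty}\frac{2\log n}{-\log(R_n(\nu)-R_\infty(\nu))},$$ if this limit exists. *)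

(* Defs.v *)
From HB Require Import structures.
From mathcomp Require Import all_boot all_order all_algebra finmap.
From mathcomp Require Import all_classical all_reals all_analysis.

Set Implicit Arguments.
Unset Strict Implicit.
Unset Printing Implicit Defensive.

Import Order.TTheory GRing.Theory Num.Theory.
Import numFieldNormedType.Exports.

Local Open Scope classical_set_scope.
Local Open Scope ring_scope.

(* The canonical norm on [R * R] is the sup norm, hence the explicit formula. *)
Definition eucl_dist (R : realType) (p q : R * R) : R :=
  Num.sqrt ((p.1 - q.1) ^+ 2 + (p.2 - q.2) ^+ 2).

Section ConstrainedQuantization.
Variables (R : realType) (mu : probability (R * R)%type R).
Variable C : nat -> set (R * R).

Local Open Scope ereal_scope.

Definition distortion (gamma : {fset R * R}) : \bar R :=
  \int[mu]_x \big[Order.min/+oo]_(a <- gamma) ((eucl_dist x a) ^+ 2)%:E.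

(* Indices start at 1: neither [C 0] nor [quant_error 0] plays any role. *)
Definition admissible (n : nat) (gamma : {fset R * R}) : Prop :=
  [set` gamma] `<=` \bigcup_(j in [set j | (1 <= j <= n)%N]) C j /\
  (1 <= #|` gamma| <= n)%N.

Definition quant_error (n : nat) : \bar R :=
  ereal_inf [set distortion gamma | gamma in admissible n].

Definition quant_error_strictly_decreasing : Prop :=
  forall m n : nat, (1 <= m)%N -> (m < n)%N -> quant_error n < quant_error m.

Definition quant_error_infty : \bar R := limn quant_error.

(* When the errors strictly decrease they are nonnegative and, from n = 2 on,
   finite, as is their limit; so [fine] only discards the value at n = 1 of a
   measure without second moment. *)
Definition dimension_seq (n : nat) : R :=
  ((2 * ln n%:R) / - ln (fine (quant_error n - quant_error_infty)))%R.

Definition quantization_dimension_exists : Prop :=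
  quant_error_strictly_decreasing /\ cvgn dimension_seq.

Definition quantization_dimension : R := limn dimension_seq.

End ConstrainedQuantization.

Definition to_plane (R : realType) (x : measurableTypeR R) : R * R :=
  (x, 0).

Lemma measurable_to_plane (R : realType) :
  measurable_fun [set: measurableTypeR R] (@to_plane R).
Proof. exact: measurable_fun_pair. Qed.

HB.instance Definition _ (R : realType) :=
  isMeasurableFun.Build _ _ _ _ (@to_plane R) (@measurable_to_plane R).

Definition uniform01 (R : realType) : probability (R * R)%type R :=
  distribution (uniform_prob (@ltr01 R)) (@to_plane R).

Definition segment (R : realType) (j : nat) : set (R * R) :=
  [set p | - j%:R^-1 <= p.1 <= 1 /\ p.2 = p.1 + j%:R^-1].

(* Main.v *)
(* The squared distance from [(x, 0)] to [(a, a + s)] is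
   [2 (a - (x - s) / 2)^2 + (x + s)^2 / 2].  Points of [C 1], ..., [C n] have
   [s >= 1 / n], so the second summand alone gives [R_n >= 1/6 + 1/(2n)]; placing
   [n] equispaced points on [C n] makes the first summand [O(1 / n^2)], whence
   [R_n <= 1/6 + 2/n].  Thus [R_oo = 1/6] and [R_n - R_oo] is of order [1 / n].
   Strict decrease: near [x = 0] one point of [C n.+1] beats every point of
   [C 1], ..., [C n] by a margin independent of the competitor. *)
Require Import Defs.
From mathcomp Require Import all_boot all_order all_algebra finmap.
From mathcomp Require Import all_classical all_reals all_analysis.
From mathcomp Require Import measurable_realfun ring lra.

Set Implicit Arguments.
Unset Strict Implicit.
Unset Printing Implicit Defensive.

Import Order.TTheory GRing.Theory Num.Theory.
Import numFieldNormedType.Exports.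

Local Open Scope classical_set_scope.
Local Open Scope ring_scope.

(** * Sequences of order 1/n on a logarithmic scale *)

Section LimitOfLogRatio.
Context {R : realType}.

Lemma cvgn_ln_natr : (ln n%:R : R) @[n --> \oo] --> +oo.
Proof.
apply/cvgryPge => A; near=> n.
rewrite -ler_expR lnK ?posrE; first by near: n; exact: nbhs_infty_ger.
by rewrite ltr0n; near: n; exact: nbhs_infty_gt.
Unshelve. all: by end_near. Qed.

(** Taking logarithms puts [ln (r n)] within [ln c] of [- ln n]; division by [ln n] then makes the
    constant [c] vanish in the limit. *)
Lemma cvgn_ln_ratio (r : nat -> R) (c : R) : 0 < c ->
  (forall n, (0 < n)%N -> c^-1 * n%:R^-1 <= r n <= c * n%:R^-1) ->
  2 * ln n%:R / - ln (r n) @[n --> \oo] --> (2 : R).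
Proof.
move=> c0 rc.
(* The reciprocal ratio has the explicit denominator [ln n], so it can be squeezed directly;
   inversion is continuous at 1. *)
suff H : (- ln (r n)) / ln n%:R @[n --> \oo] --> (1 : R).
  under eq_fun do rewrite -mulrA -[ln _ / _]invf_div.
  have : 2 * (- ln (r n) / ln n%:R)^-1 @[n --> \oo] --> (2 * 1^-1 : R).
    by apply: cvgM; [exact: cvg_cst|apply: cvgV => //; exact: oner_neq0].
  by rewrite invr1 mulr1.
have ln_gt0 : \forall n \near \oo, 0 < ln n%:R :> R.
  near=> n; apply: ln_gt0; rewrite ltr1n.
  by near: n; exact: nbhs_infty_gt.
have V0 (a : R) : a / ln n%:R @[n --> \oo] --> (0 : R).
  rewrite -(mulr0 a); apply: cvgM; first exact: cvg_cst.
  by apply/gtr0_cvgV0 => //; exact: cvgn_ln_natr.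
apply: (@squeeze_cvgr _ _ _ _ (fun n => 1 - ln c / ln n%:R)
    (fun n => 1 + ln c / ln n%:R)); last 2 first.
- have := cvgB (cvg_cst (1 : R)) (V0 (ln c)).
  by rewrite subr0; exact.
- have := cvgD (cvg_cst (1 : R)) (V0 (ln c)).
  by rewrite addr0; exact.
near=> n.
have lnn : 0 < ln n%:R :> R by near: n.
have n0 : (0 < n)%N by near: n; exact: nbhs_infty_gt.
have n0R : 0 < n%:R^-1 :> R by rewrite invr_gt0 ltr0n.
have /andP[lo up] := rc n n0.
have rn0 : 0 < r n by rewrite (lt_le_trans _ lo)// mulr_gt0// invr_gt0.
have lo' : - ln c - ln n%:R <= ln (r n).
  rewrite -!lnV ?posrE ?ltr0n// -lnM ?posrE ?invr_gt0 ?ltr0n//.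
  by rewrite ler_ln ?posrE// mulr_gt0// invr_gt0.
have up' : ln (r n) <= ln c - ln n%:R.
  rewrite -lnV ?posrE ?ltr0n// -lnM ?posrE//.
  by rewrite ler_ln ?posrE// mulr_gt0.
rewrite ler_pdivlMr// ler_pdivrMr// mulrBl mulrDl divfK ?gt_eqF// mul1r.
by apply/andP; split; lra.
Unshelve. all: by end_near. Qed.

End LimitOfLogRatio.

(** * Distances to lines of slope one, and grids in the unit interval *)

Section Geometry.
Context {R : realType}.

Lemma eucl_dist_sqr (p q : R * R) :
  eucl_dist p q ^+ 2 = (p.1 - q.1) ^+ 2 + (p.2 - q.2) ^+ 2.
Proof. by rewrite sqr_sqrtr// addr_ge0 ?sqr_ge0. Qed.

Lemma eucl_dist_diagonal (x a s : R) :
  eucl_dist (x, 0) (a, a + s) ^+ 2 =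
  2 * (a - (x - s) / 2) ^+ 2 + (x + s) ^+ 2 / 2.
Proof. by rewrite eucl_dist_sqr/=; field. Qed.

Lemma grid_approx (n : nat) (x : R) : (0 < n)%N -> 0 <= x <= 1 ->
  exists2 i, (i < n)%N & `|x - i%:R / n%:R| <= n%:R^-1.
Proof.
move=> n0 /andP[x0 x1]; have n0R : 0 < n%:R :> R by rewrite ltr0n.
have nx0 : 0 <= x * n%:R by rewrite mulr_ge0// ltW.
suff [i ltin] : exists2 i, (i < n)%N & i%:R <= x * n%:R <= i.+1%:R.
  move=> /andP[l u]; exists i => //.
  have n1 : 0 <= n%:R^-1 :> R by rewrite invr_ge0 ltW.
  rewrite -{1}(mulfK (lt0r_neq0 n0R) x) -mulrBl normrM (ger0_norm n1).
  rewrite ler_piMl// ler_norml.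
  by rewrite -natr1 in u; apply/andP; split; lra.
(* The endpoint [x = 1] is separate: its truncation [n] would be one past the last grid index, so
   the last cell serves instead. *)
have [x1'|/(conj x1)/andP/le_anti->] := ltP x 1; last first.
  exists n.-1; first by rewrite prednK.
  by rewrite mul1r prednK// lexx andbT ler_nat leq_pred.
exists (Num.truncn (x * n%:R)).
  by rewrite truncn_lt_nat// gtr_pMl.
by rewrite truncn_le nx0/= ltW// truncnS_gt.
Qed.

End Geometry.

(** * The distortion as a Lebesgue integral over the unit interval *)

Section Integration.
Context {R : realType}.
Local Open Scope ereal_scope.

Implicit Types (gamma : {fset R * R}) (p : R * R).

Definition sqr_dist_to gamma p : \bar R :=
  \big[Order.min/+oo]_(a <- gamma) ((eucl_dist p a) ^+ 2)%:E.

Lemma sqr_dist_to_ge0 gamma p : 0 <= sqr_dist_to gamma p.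
Proof. by apply: le_bigmin => // a _; rewrite lee_fin sqr_ge0. Qed.

Lemma measurable_sqr_dist_to gamma :
  measurable_fun setT (sqr_dist_to gamma).
Proof.
rewrite /sqr_dist_to; elim: (enum_fset gamma) => [|a s IH].
  by under eq_fun do rewrite big_nil; exact: measurable_cst.
under eq_fun do rewrite big_cons; apply: measurable_mine => //.
apply/measurable_EFinP; under eq_fun do rewrite eucl_dist_sqr.
by apply: measurable_funD; apply: measurable_funX; apply: measurable_funB.
Qed.

Lemma measurable_sqr_dist_to_plane gamma (D : set (measurableTypeR R)) :
  measurable_fun D (sqr_dist_to gamma \o @to_plane R).
Proof.
apply: (measurable_funS measurableT) => //.
exact: measurableT_comp (measurable_sqr_dist_to gamma) (@measurable_to_plane R).
Qed.

(** The image measure pulls back along [to_plane], and the uniform density on the unit interval is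
    1. *)
Lemma distortion_uniform01 gamma :
  distortion (uniform01 R) gamma =
  \int[lebesgue_measure]_(x in `[0%R, 1%R]) sqr_dist_to gamma (to_plane x).
Proof.
rewrite /distortion /uniform01 ge0_integral_distribution; last 2 first.
- exact: measurable_sqr_dist_to.
- exact: sqr_dist_to_ge0.
rewrite integral_uniform; last 2 first.
- exact: measurable_sqr_dist_to_plane.
- by move=> x; exact: sqr_dist_to_ge0.
by rewrite subr0 invr1 mul1e.
Qed.

(** Serves both error bounds with [s = 1/n]: the lower one takes [c = 0], the upper one
    [c = s^2 / 2]. The function [F] below is a primitive of the integrand. *)
Lemma integral_parabola (s c : R) :
  \int[lebesgue_measure]_(x in `[0%R, 1%R]) ((x + s) ^+ 2 / 2 + c)%:E =
  (6^-1 + s / 2 + s ^+ 2 / 2 + c)%:E.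
Proof.
pose F (x : R) := ((x + s) ^+ 3 / 6 + c * x)%R.
pose f (x : R) := ((x + s) ^+ 2 / 2 + c)%R.
have derive_continuous (g g' : R -> R) :
    (forall x, is_derive x (1 : R)%R g (g' x)) -> continuous g.
  move=> dg x; apply/differentiable_continuous/derivable1_diffP.
  by have [] := dg x.
have dF (x : R) : is_derive x (1 : R)%R F (f x).
  by rewrite /F /f; apply: is_derive_eq; rewrite /GRing.scale/=; field.
have cF : continuous F by exact: derive_continuous dF.
have cf : continuous f.
  apply: (derive_continuous _ (fun x => x + s)%R) => x.
  by rewrite /f; apply: is_derive_eq; rewrite /GRing.scale/=; field.
rewrite (@continuous_FTC2 _ _ F)//; first 1 last.
- exact: continuous_subspaceT.
- split.
  + by move=> x _; have [] := dF x.
  + exact/cvg_at_right_filter/cF.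
  + exact/cvg_at_left_filter/cF.
- by move=> x _; rewrite derive1E; have [_ ->] := dF x.
by rewrite -EFinB /F; congr EFin; field.
Qed.

End Integration.

(** * Two-sided bounds of order 1/n for the excess over 1/6 *)

Section Segments.
Context {R : realType}.
Local Open Scope ereal_scope.

Notation C := (@segment R).
Notation nu := (uniform01 R).

Lemma sqr_dist_to_segments_ge n (gamma : {fset R * R}) (x : R) :
  admissible C n gamma -> (0 <= x)%R ->
  ((x + n%:R^-1) ^+ 2 / 2)%:E <= sqr_dist_to gamma (to_plane x).
Proof.
move=> [gammaC _] x0; rewrite /sqr_dist_to big_seq.
apply: le_bigmin => [|p /gammaC]; first exact: leey.
case: p => a b [j/= /andP[j0 jn]] [_ /= ->].
have jnR : (n%:R^-1 <= j%:R^-1 :> R)%R.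
  by rewrite lef_pV2 ?posrE ?ltr0n ?ler_nat// (leq_trans j0 jn).
rewrite /to_plane eucl_dist_diagonal lee_fin.
(* As [x] is nonnegative, the square grows with the offset, which is least for [j = n]. *)
rewrite (@le_trans _ _ ((x + j%:R^-1) ^+ 2 / 2))%R//.
  by rewrite ler_pM2r ?invr_gt0// lerXn2r ?nnegrE ?addr_ge0// lerD2l.
by rewrite lerDr mulr_ge0// sqr_ge0.
Qed.

Lemma distortion_ge n (gamma : {fset R * R}) : admissible C n gamma ->
  (6^-1 + n%:R^-1 / 2)%:E <= distortion nu gamma.
Proof.
move=> adm; rewrite distortion_uniform01.
(* The quadratic term of the exact integral is dropped; the final 0 is the [c] of
   [integral_parabola]. *)
apply: (@le_trans _ _ (6^-1 + n%:R^-1 / 2 + n%:R^-1 ^+ 2 / 2 + 0)%:E).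
  by rewrite lee_fin addr0 lerDl divr_ge0// sqr_ge0.
rewrite -integral_parabola; apply: ge0_le_integral => //.
- by move=> x _; rewrite lee_fin addr0 divr_ge0// sqr_ge0.
- apply/measurable_EFinP; apply: measurable_funD => //.
  apply: measurable_funM => //; apply: measurable_funX.
  exact: measurable_funD.
- exact: measurable_sqr_dist_to_plane.
- move=> x /=; rewrite in_itv/= addr0 => /andP[x0 _].
  exact: sqr_dist_to_segments_ge.
Qed.

(* The optimal point of [C n] for the parameter [x] is the projection of
   [(x, 0)], whose abscissa is [(x - n^-1) / 2]; we take it for [x = i / n]. *)
Definition projected_grid n : {fset R * R} :=
  seq_fset tt [seq ((i%:R / n%:R - n%:R^-1) / 2,
                    (i%:R / n%:R - n%:R^-1) / 2 + n%:R^-1)%R | i <- iota 0 n].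

Lemma projected_grid_admissible n : (0 < n)%N ->
  admissible C n (projected_grid n).
Proof.
move=> n0; have n0R : (0 < n%:R :> R)%R by rewrite ltr0n.
split; last first.
  apply/andP; split; last first.
    by rewrite size_seq_fset (leq_trans (size_undup _))// size_map size_iota.
  rewrite cardfs_gt0; apply/fset0Pn.
  exists ((0%:R / n%:R - n%:R^-1) / 2,
          (0%:R / n%:R - n%:R^-1) / 2 + n%:R^-1)%R.
  rewrite seq_fsetE; apply/mapP; exists 0%N => //.
  by rewrite mem_iota.
move=> p; rewrite /= seq_fsetE => /mapP[i]; rewrite mem_iota/= add0n => ltin ->.
exists n => /=; first by rewrite n0 leqnn.
split=> //=; have := ltin; rewrite -(ltr_nat R) => /ltW lein.
have : (i%:R / n%:R <= 1 :> R)%R by rewrite ler_pdivrMr// mul1r.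
have : (0 <= i%:R / n%:R :> R)%R by rewrite divr_ge0.
have : (0 <= n%:R^-1 :> R)%R by rewrite invr_ge0.
by move=> ? ? ?; apply/andP; split; lra.
Qed.

(** A parameter error of at most 1/n moves the abscissa of the projection by at most 1/(2n), which
    costs at most 2 (1/(2n))^2. *)
Lemma sqr_dist_to_projected_grid_le n (x : R) : (0 < n)%N ->
  (0 <= x <= 1)%R ->
  sqr_dist_to (projected_grid n) (to_plane x) <=
  ((x + n%:R^-1) ^+ 2 / 2 + n%:R^-1 ^+ 2 / 2)%:E.
Proof.
move=> n0 /(grid_approx n0)[i ltin xi].
set a : R := ((i%:R / n%:R - n%:R^-1) / 2)%R.
apply: (@bigmin_inf_seq _ _ _ _ _ (a, a + n%:R^-1)%R) => //.
  by rewrite seq_fsetE; apply/mapP; exists i; rewrite // mem_iota.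
rewrite /to_plane eucl_dist_diagonal lee_fin addrC lerD2l.
have : ((x - i%:R / n%:R) ^+ 2 <= n%:R^-1 ^+ 2)%R.
  by rewrite -real_normK ?num_real// lerXn2r ?nnegrE ?invr_ge0.
by rewrite /a; nra.
Qed.

Lemma quant_error_ge n : (6^-1 + n%:R^-1 / 2)%:E <= quant_error nu C n.
Proof. by apply/ereal_infP => _ [gamma adm <-]; exact: distortion_ge. Qed.

(** The integral gives 1/6 + 1/(2n) + 1/n^2, hence at most 1/6 + 3/(2n). The rounder constant 2 is
    the inverse of the 1/2 in [quant_error_ge], as [cvgn_ln_ratio] requires. *)
Lemma quant_error_le n : (0 < n)%N ->
  quant_error nu C n <= (6^-1 + 2 * n%:R^-1)%:E.
Proof.
move=> n0; apply: ge_ereal_inf; exists (distortion nu (projected_grid n)).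
  by exists (projected_grid n) => //; exact: projected_grid_admissible.
rewrite distortion_uniform01.
apply: (@le_trans _ _
    (6^-1 + n%:R^-1 / 2 + n%:R^-1 ^+ 2 / 2 + n%:R^-1 ^+ 2 / 2)%:E); last first.
  have : (n%:R^-1 <= 1 :> R)%R by rewrite invf_le1 ?ltr0n// ler1n.
  have : (0 <= n%:R^-1 :> R)%R by rewrite invr_ge0.
  by rewrite lee_fin => ? ?; nra.
rewrite -integral_parabola; apply: ge0_le_integral => //.
- by move=> x _; exact: sqr_dist_to_ge0.
- exact: measurable_sqr_dist_to_plane.
- apply/measurable_EFinP; apply: measurable_funD => //.
  apply: measurable_funM => //; apply: measurable_funX.
  exact: measurable_funD.
- by move=> x /=; rewrite in_itv/=; exact: sqr_dist_to_projected_grid_le.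
Qed.

Lemma quant_error_fin_num n : (0 < n)%N -> quant_error nu C n \is a fin_num.
Proof.
move=> n0; have lower := quant_error_ge n.
rewrite ge0_fin_numE; first exact: le_lt_trans (quant_error_le n0) (ltry _).
by rewrite (le_trans _ lower)// lee_fin addr_ge0// divr_ge0.
Qed.

(** * Strict decrease of the errors *)

(* The gain comes from adding the point of [C n.+1] closest to the origin.
   Its uniformity is what makes the infima, not only the distortions, drop
   strictly. *)
Lemma distortion_refine n : (0 < n)%N -> exists2 e : R, (0 < e)%R &
  forall gamma, admissible C n gamma ->
  exists2 gamma', admissible C n.+1 gamma' &
    distortion nu gamma' + e%:E <= distortion nu gamma.
Proof.
move=> n0; set c : R := (n%:R^-1)%R; set s : R := (n.+1%:R^-1)%R.
have s0 : (0 < s)%R by rewrite invr_gt0.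
have sc : (s < c)%R by rewrite ltf_pV2 ?posrE ?ltr0n// ltr_nat.
have c1 : (c <= 1)%R by rewrite invf_le1 ?ltr0n// ler1n.
(* The new point costs x^2/2 + (x + s)^2/2 against at least (x + c)^2/2 for [gamma]. The difference
   is h + x (d - x/2), so the gain is at least [h] on [0, d]. *)
pose d : R := (c - s)%R; pose h : R := ((c ^+ 2 - s ^+ 2) / 2)%R.
have d0 : (0 < d)%R by rewrite /d; lra.
have h0 : (0 < h)%R by rewrite /h; nra.
exists (h * d)%R; first exact: mulr_gt0.
move=> gamma adm; have [gammaC /andP[card0 cardn]] := adm.
pose p : R * R := (- s / 2, - s / 2 + s)%R.
exists (p |` gamma)%fset.
  split; last first.
    rewrite cardfsU1; apply/andP; split; first by rewrite ltn_addl.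
    by rewrite -addn1 addnC leq_add// leq_b1.
  move=> q /=; rewrite !inE => /orP[/eqP->|/gammaC[j /andP[j0 jn] Cjq]].
    by exists n.+1 => //=; split=> //=; rewrite -/s; apply/andP; split; lra.
  by exists j => //=; rewrite j0 ltnW.
rewrite !distortion_uniform01.
(* Writing the gain as an integral reduces the claim to a pointwise inequality; [d] is at most 1, so
   [0, d] lies in the domain. *)
have -> : (h * d)%:E =
    \int[lebesgue_measure]_(x in `[0%R, 1%R]) (h%:E * (\1_`[0%R, d] x)%:E).
  rewrite ge0_integralZl_EFin//; last 2 first.
  - by apply/measurable_EFinP; exact: measurable_indic.
  - exact: ltW.
  rewrite integral_indic// setIidl; last first.
    by move=> x /=; rewrite !in_itv/= /d => /andP[-> ?]/=; lra.
  rewrite EFinM; congr (_ * _); apply/esym.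
  by rewrite [LHS](lebesgue_measure_itv `[0%R, d])/= lte_fin d0 -EFinD subr0.
have mindic (D : set (measurableTypeR R)) :
    measurable_fun D (fun x => h%:E * (\1_`[0%R, d] x)%:E : \bar R).
  by apply/measurable_EFinP; apply: measurable_funM.
have indic_ge0 x : 0 <= h%:E * (\1_`[0%R, d] x)%:E.
  by rewrite -EFinM lee_fin mulr_ge0// ltW.
rewrite -ge0_integralD//; first last.
- exact: measurable_sqr_dist_to_plane.
- by move=> x _; exact: sqr_dist_to_ge0.
apply: ge0_le_integral => //.
- by move=> x _; rewrite adde_ge0//; exact: sqr_dist_to_ge0.
- by apply: emeasurable_funD => //; exact: measurable_sqr_dist_to_plane.
- exact: measurable_sqr_dist_to_plane.
move=> x /=; rewrite in_itv/= => /andP[x0 x1]; rewrite indicE.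
(* Outside [0, d] it is enough that adding a point cannot raise the minimum. *)
have [xd|xd] := boolP (x \in `[0%R, d]%classic); last first.
  rewrite mule0 adde0; apply: sub_bigmin_seq => q qgamma.
  by rewrite !inE qgamma orbT.
apply: le_trans (sqr_dist_to_segments_ge adm x0).
rewrite mule1 -leeBrDr//.
apply: (@bigmin_inf_seq _ _ _ _ _ p) => //; first by rewrite !inE eqxx.
rewrite /to_plane eucl_dist_diagonal -EFinB lee_fin -/c.
move: xd; rewrite inE/= in_itv/= /d /h => /andP[_ xd].
by nra.
Qed.

Lemma quant_error_ltS n : (0 < n)%N ->
  quant_error nu C n.+1 < quant_error nu C n.
Proof.
move=> n0; have [e e0 refine] := distortion_refine n0.
(* Adding [e] is a strict increase because the error is finite. *)
apply: (@lt_le_trans _ _ (quant_error nu C n.+1 + e%:E)).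
  by rewrite lteDl ?lte_fin// quant_error_fin_num.
apply/ereal_infP => _ [gamma /refine[gamma' adm' le] <-].
apply: le_trans le; rewrite leeD2r//.
by apply: ereal_inf_lbound; exists gamma'.
Qed.

Lemma quant_error_decreasing : quant_error_strictly_decreasing nu C.
Proof.
move=> m n m0; elim: n => // n IH; rewrite ltnS leq_eqVlt => /predU1P[<-|mn].
  exact: quant_error_ltS.
apply: lt_trans (IH mn); apply: quant_error_ltS.
exact: leq_trans m0 (ltnW mn).
Qed.

(** * The limiting error and the dimension *)

Lemma quant_error_inftyE : quant_error_infty nu C = 6^-1%:E.
Proof.
(* Both bounds on the error have this form, with [a] equal to 1/2 and 2. *)
have cV (a : R) : (6^-1 + a * n%:R^-1)%:E @[n --> \oo] --> 6^-1%:E.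
  apply: cvg_EFin; first by near=> n.
  have inv0 : (n%:R^-1)%R @[n --> \oo] --> (0%R : R).
    apply/gtr0_cvgV0; last exact: cvgr_idn.
    by near=> n; rewrite ltr0n; near: n; exact: nbhs_infty_gt.
  have := cvgD (cvg_cst (6^-1 : R)%R) (cvgM (cvg_cst a) inv0).
  by rewrite mulr0 addr0; exact.
apply/cvg_lim => //; apply: squeeze_cvge (cV 2^-1%R) (cV 2%R).
near=> n; rewrite mulrC quant_error_ge quant_error_le//.
by near: n; exact: nbhs_infty_gt.
Unshelve. all: by end_near. Qed.

Lemma cvgn_dimension_seq : dimension_seq nu C n @[n --> \oo] --> (2%R : R).
Proof.
apply: (@cvgn_ln_ratio _ (fun n => fine (quant_error nu C n - _)) 2%R) => // n n0.
rewrite quant_error_inftyE.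
have := quant_error_ge n; have := quant_error_le n0.
case: (quant_error nu C n) (quant_error_fin_num n0) => // r _.
by rewrite !lee_fin/= => ? ?; apply/andP; split; lra.
Qed.

End Segments.

Theorem theorem3p7 (R : realType) :
  quantization_dimension_exists (uniform01 R) (@segment R) /\
  quantization_dimension (uniform01 R) (@segment R) = 2.
Proof.
have cvg2 := @cvgn_dimension_seq R.
split; last exact/cvg_lim.
by split; [exact: quant_error_decreasing|apply/cvg_ex; exists 2].
Qed.
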